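(* Let $\Delta$ and $\Lambda$ be distance value sets with $\inf\Delta=\inf\Lambda=0$. Then $\Delta$ and $\Lambda$ are equivalent if and only if there is a positive real number $\alpha$ with $\Lambda=\alpha\cdot\Delta$. Moreover, if $\Delta$ and $\Lambda$ are equivalent, then every bijection $f:\Delta\to\Lambda$ witnessing their equivalence has the form $f(x)=\alpha x$ for some positive real $\alpha$.
   Context: A distance value set is a set $\Delta$ of positive real numbers such that for all $x,y\in\Delta$, $\min\{x+y,\sup\Delta\}\in\Delta$. A triple $(x,y,z)$ of positive reals is a $\Delta$-triangle if $x,y,z\in\Delta$ and $|x-y|\le z\le x+y$. $\Delta$ and $\Lambda$ are equivalent if there is a bijection $f:\Delta\to\Lambda$ (a witness) such that for all positive reals $x,y,z$, $(x,y,z)$ is a $\Delta$-triangle iff $(f(x),f(y),f(z))$ is a $\Lambda$-triangle. *)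

(* Defs.v *)
From mathcomp Require Import all_boot all_order all_algebra.
From mathcomp Require Import all_classical all_reals all_analysis.
Set Implicit Arguments.
Unset Strict Implicit.
Unset Printing Implicit Defensive.
Import Order.TTheory GRing.Theory Num.Theory.
Local Open Scope classical_set_scope.
Local Open Scope ring_scope.

(* Suprema and infima are taken in the extended reals, so that
   sup D = +oo when D is unbounded and inf set0 = +oo, whereas the
   real-valued [sup] and [inf] return 0 in these degenerate cases. *)
Definition esup (R : realType) (D : set R) : \bar R :=
  ereal_sup [set x%:E | x in D].

Definition einf (R : realType) (D : set R) : \bar R :=
  ereal_inf [set x%:E | x in D].

Definition distance_value_set (R : realType) (D : set R) : Prop :=
  (forall x, D x -> 0 < x) /\
  (forall x y, D x -> D y ->
     [set z%:E | z in D] (Order.min (x + y)%:E (esup D))).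

Definition triangle (R : realType) (D : set R) (x y z : R) : Prop :=
  [/\ 0 < x, 0 < y & 0 < z] /\
  [/\ D x, D y, D z & `|x - y| <= z <= x + y].

(* A map D -> L is represented by a total function of which only the values
   on D matter; hence x, y and z range over D. *)
Definition equivalence_witness (R : realType) (D L : set R) (f : R -> R)
    : Prop :=
  set_bij D L f /\
  (forall x y z, D x -> D y -> D z ->
     triangle D x y z <-> triangle L (f x) (f y) (f z)).

Definition equivalent (R : realType) (D L : set R) : Prop :=
  exists f : R -> R, equivalence_witness D L f.

(* Main.v *)
Require Import Defs.
From mathcomp Require Import all_boot all_order all_algebra.
From mathcomp Require Import all_classical all_reals all_analysis.
From mathcomp Require Import lra.
Set Implicit Arguments.
Unset Strict Implicit.
Unset Printing Implicit Defensive.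
Import Order.TTheory GRing.Theory Num.Theory.
Local Open Scope classical_set_scope.
Local Open Scope ring_scope.

(** A distance value set with infimum 0 contains all multiples of its small
elements below its supremum, hence is dense there.  Since [(w, w, z)] is a
triangle iff [z <= 2 w], density makes the relation [x <= y] definable from
triangles, so a witness [f] is an order isomorphism.  The truncated sum of [x]
and [y] is the largest third side of a triangle with sides [x] and [y]; hence
[f] is additive on sums below the supremum, and it is subadditive in general.
Squeezing [x] and [y] between consecutive multiples of a small [e] bounds
[f x * y - f y * x] by [(x + y + e) * f e], which tends to 0. *)

Section DistanceValueSet.
Variables (R : realType) (D : set R).
Hypothesis hD : distance_value_set D.

Lemma dvs_gt0 {x} : D x -> 0 < x.
Proof. by case: hD => H _; exact: H. Qed.

Lemma le_esup x : D x -> (x%:E <= esup D)%E.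
Proof. by move=> Dx; apply: ereal_sup_ubound; exists x. Qed.

(** The witness is the truncated sum [min (x + y) (esup D)]. If truncation occurs, [z] is the
    supremum itself and hence the maximum of [D]. *)
Lemma dvs_add x y : D x -> D y ->
  exists z, [/\ D z, x <= z, y <= z, z <= x + y &
    z = x + y \/ forall s, D s -> s <= z].
Proof.
move=> Dx Dy; have [_ /(_ x y Dx Dy) [z Dz zE]] := hD.
have x0 := dvs_gt0 Dx; have y0 := dvs_gt0 Dy.
exists z; split => //.
- by rewrite -lee_fin zE le_min le_esup// lee_fin lerDl ltW.
- by rewrite -lee_fin zE le_min le_esup// lee_fin lerDr ltW.
- by rewrite -lee_fin zE ge_min lexx.
- case: (leP (x + y)%:E (esup D)) zE => _; first by case=> ->; left.
  by move=> zE; right=> s Ds; rewrite -lee_fin zE le_esup.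
Qed.

Lemma dvs_addlt x y s : D x -> D y -> D s -> x + y < s -> D (x + y).
Proof.
move=> Dx Dy Ds lt; have [z [Dz _ _ zle [<-//|/(_ s Ds) sz]]] := dvs_add Dx Dy.
by move: (lt_le_trans lt (le_trans sz zle)); rewrite ltxx.
Qed.

Lemma dvs_mul e s n : D e -> D s -> n.+1%:R * e < s -> D (n.+1%:R * e).
Proof.
move=> De Ds; have e0 := dvs_gt0 De.
elim: n => [|n IH]; first by rewrite mul1r.
rewrite -natr1 mulrDl mul1r => lt.
by apply: (dvs_addlt _ De Ds lt); apply: IH; lra.
Qed.

Lemma squeeze_multiples (e x : R) : 0 < e < x ->
  exists n, n.+1%:R * e < x <= n.+2%:R * e.
Proof.
move=> /andP[e0 ex].
have exn : exists n, x <= n%:R * e.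
  exists (Num.truncn (x / e)).+1.
  by rewrite -ler_pdivrMr// ltW// truncnS_gt.
(* The least [n] with [x <= n%:R * e] is at least 2, because [0 < e < x]. *)
case: (ex_minnP exn) => -[|[|n]]; [lra | lra |] => xn nmin.
exists n; rewrite xn andbT ltNge; apply/negP => /nmin.
by rewrite ltnn.
Qed.

Hypothesis infD : einf D = 0%:E.

Lemma dvs_small e : 0 < e -> exists2 x, D x & x < e.
Proof.
move=> e0; have : (einf D < e%:E)%E by rewrite infD lte_fin.
by move=> /ereal_inf_lt[_ [x Dx <-]]; rewrite lte_fin => xe; exists x.
Qed.

(** For [e] in [D] below [b - a], the last multiple of [e] before [b] exceeds [a]; being below [s],
    it is not truncated. *)
Lemma dvs_dense a b s : D s -> 0 <= a -> a < b -> b <= s ->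
  exists2 w, D w & a < w < b.
Proof.
move=> Ds a0 ab bs; have [|e De eab] := @dvs_small (b - a); first lra.
have e0 := dvs_gt0 De.
have [|n /andP[nb bn]] := @squeeze_multiples e b; first by apply/andP; split; lra.
exists (n.+1%:R * e); first by apply: dvs_mul De Ds _; lra.
by rewrite nb andbT; move: bn; rewrite -natr1 mulrDl mul1r; lra.
Qed.

(** If [y < x], any [w] in [D] between [y / 2] and [x / 2] refutes the hypothesis. *)
Lemma dvs_leP x y : D x -> D y ->
  (forall w, D w -> y <= w + w -> x <= w + w) -> x <= y.
Proof.
move=> Dx Dy H; rewrite leNgt; apply/negP => yx.
have y0 := dvs_gt0 Dy.
have [||||w Dw /andP[w1 w2]] := @dvs_dense (y / 2) (x / 2) x => //; try lra.
have := H w Dw; lra.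
Qed.

End DistanceValueSet.

Section Witness.
Variables (R : realType) (D L : set R) (f : R -> R).
Hypotheses (hD : distance_value_set D) (hL : distance_value_set L).
Hypotheses (infD : einf D = 0%:E) (infL : einf L = 0%:E).
Hypothesis hf : equivalence_witness D L f.

Let LF {x} : D x -> L (f x).
Proof. by case: hf => -[fun_f _ _] _; exact: fun_f. Qed.

Let surjF {y} : L y -> exists2 x, D x & f x = y.
Proof. by case: hf => -[_ _ surj_f] _ /surj_f. Qed.

Lemma witness_triangle x y z : D x -> D y -> D z ->
  (`|x - y| <= z <= x + y) = (`|f x - f y| <= f z <= f x + f y).
Proof.
move=> Dx Dy Dz; case: hf => _ /(_ x y z Dx Dy Dz) [H1 H2].
apply/idP/idP => H.
- by case: H1 => [|_ []//]; split; split=> //; apply: (dvs_gt0 hD).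
- case: H2 => [|_ []//].
  by split; split; do ?[exact: LF] => //; apply: (dvs_gt0 hL); apply: LF.
Qed.

Lemma witness_le_double z w : D z -> D w -> (z <= w + w) = (f z <= f w + f w).
Proof.
move=> Dz Dw; have := witness_triangle Dw Dw Dz.
by rewrite !subrr !normr0 (ltW (dvs_gt0 hD Dz)) (ltW (dvs_gt0 hL (LF Dz))).
Qed.

Lemma witness_le x y : D x -> D y -> (f x <= f y) = (x <= y).
Proof.
move=> Dx Dy; apply/idP/idP => xy.
- apply: (dvs_leP hD infD) => // w Dw.
  rewrite (witness_le_double Dy Dw) (witness_le_double Dx Dw).
  exact: le_trans.
(* Here the test points range over [L]; surjectivity pulls them back to [D]. *)
- apply: (dvs_leP hL infL); do ?[exact: LF].
  move=> _ /surjF[w Dw <-]; rewrite -!witness_le_double//.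
  exact: le_trans.
Qed.

Lemma witness_lt x y : D x -> D y -> (f x < f y) = (x < y).
Proof. by move=> Dx Dy; rewrite !ltNge witness_le. Qed.

Lemma witness_subadd x y z : D x -> D y -> D z ->
  z <= x + y -> f z <= f x + f y.
Proof.
move=> Dx Dy Dz zxy.
have fx0 := dvs_gt0 hL (LF Dx); have fy0 := dvs_gt0 hL (LF Dy).
have [xyz|] := leP `|x - y| z.
  by have := witness_triangle Dx Dy Dz; rewrite xyz zxy => /esym/andP[].
have x0 := dvs_gt0 hD Dx; have y0 := dvs_gt0 hD Dy.
(* With no triangle, [z] is smaller than [x] or [y], and monotonicity suffices. *)
rewrite ltr_normr => /orP[] H.
- have : f z < f x by rewrite witness_lt//; lra.
  lra.
- have : f z < f y by rewrite witness_lt//; lra.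
  lra.
Qed.

(** The truncated sum of [f x] and [f y] is some [f w], and pulling the triangle back gives
    [w <= x + y]. *)
Lemma witness_superadd x y s : D x -> D y -> D s -> x + y < s ->
  f x + f y <= f (x + y).
Proof.
move=> Dx Dy Ds xys; have Dxy := dvs_addlt hD Dx Dy Ds xys.
have [_ [/surjF[w Dw <-]]] := dvs_add hL (LF Dx) (LF Dy).
move=> xw yw wxy.
have wle : f w <= f (x + y).
  have fx0 := dvs_gt0 hL (LF Dx); have fy0 := dvs_gt0 hL (LF Dy).
  have dw : `|f x - f y| <= f w by rewrite ler_norml; apply/andP; split; lra.
  have := witness_triangle Dx Dy Dw.
  by rewrite dw wxy witness_le// => /andP[].
(* If the sum in [L] were truncated, [f w] would be maximal, forcing [s <= w <= x + y]. *)
case=> [<-//|/(_ _ (LF Ds))].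
by rewrite witness_le//; move: wle; rewrite witness_le//; lra.
Qed.

Lemma witness_mul e s n : D e -> D s -> n.+1%:R * e < s ->
  n.+1%:R * f e <= f (n.+1%:R * e).
Proof.
move=> De Ds; have e0 := dvs_gt0 hD De.
elim: n => [|n IH]; first by rewrite !mul1r.
rewrite -natr1 !mulrDl !mul1r => lt.
have lt' : n.+1%:R * e < s by lra.
have := witness_superadd (dvs_mul hD De Ds lt') De Ds lt.
have := IH lt'; lra.
Qed.

Lemma witness_bounds e x : D e -> D x -> e < x ->
  exists n, [/\ n.+1%:R * e < x, x <= n.+2%:R * e,
    n.+1%:R * f e <= f x & f x <= n.+2%:R * f e].
Proof.
move=> De Dx ex; have e0 := dvs_gt0 hD De.
have [|n /andP[nx xn]] := @squeeze_multiples R e x; first by apply/andP.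
have Dn := dvs_mul hD De Dx nx.
exists n; split => //.
- by apply: le_trans (witness_mul De Dx nx) _; rewrite witness_le// ltW.
(* The multiple above [x] may lie outside [D], so subadditivity is applied to the one below [x], to
   which the induction hypothesis applies. *)
- elim: {Dn} n x Dx {ex} nx xn => [|n IH] x Dx nx xn.
    have := witness_subadd De De Dx; lra.
  have xn' : x <= n.+2%:R * e + e.
    by move: xn; rewrite -natr1 mulrDl mul1r.
  have Dn2 := dvs_mul hD De Dx nx.
  have := witness_subadd Dn2 De Dx xn'.
  have := IH _ Dn2; rewrite lexx ltr_pM2r// ltr_nat ltnSn.
  move=> /(_ isT isT); rewrite -(natr1 n.+2) mulrDl mul1r; lra.
Qed.

Lemma witness_cross_le x y : D x -> D y -> f x * y <= f y * x.
Proof.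
move=> Dx Dy.
have x0 := dvs_gt0 hD Dx; have y0 := dvs_gt0 hD Dy.
apply/ler_addgt0Pr => eps eps0.
(* As [e < x], the error [(x + y + e) * f e] is at most [(x + y + x) * f e], whose factor does not
   depend on [e]. *)
have eta0 : 0 < eps / (x + y + x) by rewrite divr_gt0//; lra.
have [_ /surjF[d Dd <-] deta] := dvs_small infL eta0.
(* Taking [e < d] makes [f e] small by monotonicity. *)
have [|e De] := @dvs_small _ _ infD (Num.min d (Num.min x y)).
  by rewrite !lt_min x0 y0 (dvs_gt0 hD).
rewrite !lt_min => /and3P[ed ex ey].
have e0 := dvs_gt0 hD De; have fe0 := dvs_gt0 hL (LF De).
have fed : f e < eps / (x + y + x) by apply: lt_trans deta; rewrite witness_lt.
rewrite ltr_pdivlMr in fed; last lra.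
have [k [k1 k2 _ k4]] := witness_bounds De Dx ex.
have [m [m1 m2 m3 _]] := witness_bounds De Dy ey.
have H1 : f x * y <= (k.+2%:R * f e) * (m.+2%:R * e).
  by apply: ler_pM => //; rewrite ltW// (dvs_gt0 hL (LF _)).
have H2 : (m.+1%:R * f e) * (k.+1%:R * e) <= f y * x.
  by apply: ler_pM => //; rewrite ?mulr_ge0 ?ler0n// ltW.
move: H1 H2 k1 m1; rewrite -!(natr1 _.+1).
set K := k.+1%:R; set M := m.+1%:R => H1 H2 k1 m1.
(* The left side is the gap between the outer bounds, as [(K + 1) * (M + 1) - K * M = K + M + 1]. *)
have H3 : (K * e + M * e + e) * f e <= (x + y + x) * f e.
  by apply: ler_wpM2r; [exact: ltW | lra].
lra.
Qed.

Lemma witness_linear :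
  exists alpha : R, 0 < alpha /\ forall x, D x -> f x = alpha * x.
Proof.
(* Any base point of [D] will do; the bound 1 is arbitrary. *)
have [a Da _] := dvs_small infD ltr01.
have a0 := dvs_gt0 hD Da.
exists (f a / a); split; first by rewrite divr_gt0// (dvs_gt0 hL (LF _)).
move=> x Dx; apply: (mulIf (lt0r_neq0 a0)); rewrite mulrAC divfK ?gt_eqF//.
by apply/eqP; rewrite eq_le !witness_cross_le.
Qed.

End Witness.

Lemma scaling_witness (R : realType) (D : set R) (alpha : R) : 0 < alpha ->
  equivalence_witness D [set alpha * x | x in D] ( *%R alpha).
Proof.
move=> a0; split.
  split=> [x Dx|x y _ _|y [x Dx <-]]; [by exists x | | by exists x].
  exact: (mulfI (lt0r_neq0 a0)).
move=> x y z Dx Dy Dz; rewrite /triangle !pmulr_rgt0// -mulrBr -mulrDr normrM.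
rewrite (gtr0_norm a0) !ler_pM2l//.
by split=> -[pos [_ _ _ H]]; split=> //; split=> //; apply: imageP.
Qed.

Theorem theorem4p6 (R : realType) (D L : set R)
    (hD : distance_value_set D) (hL : distance_value_set L)
    (infD : einf D = 0%:E) (infL : einf L = 0%:E) :
  (equivalent D L <->
     exists alpha : R, 0 < alpha /\ L = [set alpha * x | x in D]) /\
  (equivalent D L ->
     forall f : R -> R, equivalence_witness D L f ->
       exists alpha : R, 0 < alpha /\ forall x, D x -> f x = alpha * x).
Proof.
split; last by move=> _ f hf; exact: (witness_linear hD hL infD infL hf).
split=> [[f hf]|[alpha [a0 ->]]]; last first.
  by exists ( *%R alpha); exact: scaling_witness.
have [alpha [a0 fE]] := witness_linear hD hL infD infL hf.
exists alpha; split=> //.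
have [[fun_f _ surj_f] _] := hf.
apply/seteqP; split=> [y /surj_f[x Dx <-]|_ [x Dx <-]].
  by exists x; rewrite ?fE.
by rewrite -fE//; exact: fun_f.
Qed.
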